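(* Let $k\ge 3$ be an integer and let $G$ be a finite group of odd order. Then there are infinitely many integers $v$ for which there exists a $2$-$(v,k,1)$-design whose automorphism group has a subgroup isomorphic to $G$.
   Context: A $2$-$(v,k,1)$-design consists of a set of $v$ points together with a collection of $k$-element subsets of the points (called blocks) such that any two distinct points lie in exactly one block. An automorphism is a permutation of the points mapping the set of blocks onto itself. *)

(* Defs.v *)
From mathcomp Require Import all_boot all_fingroup.

Set Implicit Arguments.
Unset Strict Implicit.
Unset Printing Implicit Defensive.

Import GroupScope.

(* A 2-(v,k,1)-design with point set T and block set B. *)
Definition is_design (v k : nat) (T : finType) (B : {set {set T}}) : Prop :=
  [/\ #|T| = v,
      forall b : {set T}, b \in B -> #|b| = k
    & forall x y : T, x != y ->
        exists! b : {set T}, [/\ b \in B, x \in b & y \in b]].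

Section DesignAut.

Variables (T : finType) (B : {set {set T}}).

Definition design_aut : {set {perm T}} :=
  [set s : {perm T} | [set s @: (b : {set T}) | b in B] == B].

Lemma design_aut_group_set : group_set design_aut.
Proof.
apply/group_setP; split=> [|s t].
  rewrite inE; apply/eqP; rewrite -[RHS]imset_id; apply: eq_imset => b.
  by rewrite -[RHS]imset_id; apply: eq_imset => x; rewrite perm1.
rewrite !inE => /eqP sB /eqP tB; apply/eqP.
rewrite -[RHS]tB -{2}sB -imset_comp; apply: eq_imset => b /=.
by rewrite -imset_comp; apply: eq_imset => x; rewrite permM.
Qed.

Canonical design_aut_group := Group design_aut_group_set.

End DesignAut.

(* Main.v *)
Require Import Defs.
From mathcomp Require Import all_boot all_order all_fingroup all_algebra.
From mathcomp Require Import all_solvable all_field.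
From mathcomp Require Import zify ring.

(* Put n = #|G| and e = 'C(k, 2), and let F be a large finite field with
   #|F| = 1 modulo 2 n e. Following Wilson, F contains k elements b_0, ..., b_(k-1)
   whose differences b_j - b_i (i < j) represent the e cosets of the subgroup of
   index e in F^*: a second moment computation shows that, for a large set A, most
   x see about #|A| / e elements of A in each coset, so the b_i can be chosen
   greedily. The group G acts on V = F^G by translation, hence faithfully and
   linearly. A stabilizer in G of a line of V acts on it by n-th roots of unity;
   since n divides (#|F| - 1) / e and is odd, these are compatible both with the
   cosets and with a choice of one vector out of each pair {u, -u}. So there is a
   G-invariant set D of vectors such that each nonzero vector is uniquely
   (b_j - b_i) u with i != j and u in D, and the sets {w + b_i u | i}, with w in V
   and u in D, are the blocks of a G-invariant 2-(#|V|, k, 1)-design. *)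

Set Implicit Arguments.
Unset Strict Implicit.
Unset Printing Implicit Defensive.

Import Order.TTheory GRing.Theory Num.Theory.

Lemma Posz_sum (I : Type) (r : seq I) (P : pred I) (E : I -> nat) :
  ((\sum_(i <- r | P i) E i)%N%:Z = \sum_(i <- r | P i) (E i)%:Z)%R.
Proof. exact: (big_morph Posz PoszD). Qed.

(** * Cosets of the subgroup of index [e] in [F^*], and the second moment bound *)

Section PowerResidues.

Local Open Scope ring_scope.

Variable F : finFieldType.

Lemma card_exp_fiber_le (n : nat) (c : F) :
  (0 < n)%N -> (#|[set x : F | x ^+ n == c]| <= n)%N.
Proof.
move=> n0; have s : size ('X^n - c%:P) = n.+1 by rewrite size_XnsubC.
have := @max_poly_roots F ('X^n - c%:P) (enum [set x : F | x ^+ n == c]).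
rewrite s ltnS -cardE; apply; last exact: enum_uniq.
  by rewrite -size_poly_gt0 s.
by apply/allP=> x; rewrite mem_enum inE rootE !hornerE subr_eq0.
Qed.

Variables e f : nat.
Hypothesis card_F : #|F| = (e * f).+1.

Lemma index_gt0 : (0 < e)%N /\ (0 < f)%N.
Proof. by have := finNzRing_gt1 F; rewrite card_F ltnS muln_gt0 => /andP[]. Qed.

Lemma expf_order (x : F) : x != 0 -> x ^+ (e * f) = 1.
Proof.
move=> x0; apply: (mulfI x0); rewrite mulr1 -exprS -card_F; exact: expf_card.
Qed.

(** These roots label the cosets of the subgroup of index [e] in [F^*]: the coset of [x] is recorded
    by [x ^+ f]. *)
Definition unity_roots : {set F} := [set z | z ^+ e == 1].

Lemma unity_rootsP (x : F) : (x ^+ f \in unity_roots) = (x != 0).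
Proof.
have [e0 f0] := index_gt0.
rewrite inE; have [->|x0] := eqVneq x 0; last by rewrite -exprM mulnC expf_order ?eqxx.
by rewrite !expr0n !gtn_eqF //= expr0n gtn_eqF // eq_sym oner_eq0.
Qed.

(** The degree gives the upper bound. Conversely [x ^+ f] distributes the [e * f] nonzero elements
    over the roots, at most [f] to each. *)
Lemma card_unity_roots : #|unity_roots| = e.
Proof.
have [e0 f0] := index_gt0.
apply/eqP; rewrite eqn_leq card_exp_fiber_le //=.
rewrite -(leq_pmul2r f0).
have -> : (e * f = #|[set x : F | x != 0%R]|)%N.
  by have := cardsC1 (0 : F); rewrite card_F /= => <-; apply: eq_card => x; rewrite !inE.
rewrite -sum1_card (partition_big (fun x => x ^+ f) [in unity_roots]) /=; last first.
  by move=> x; rewrite inE unity_rootsP.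
rewrite -sum_nat_const leq_sum // => z _.
rewrite sum1dep_card; apply: leq_trans (card_exp_fiber_le z f0).
by apply/subset_leq_card/subsetP => x; rewrite !inE => /andP[].
Qed.

Definition nbrs (A : {set F}) (z x : F) : {set F} :=
  [set a in A | (a - x) ^+ f == z].

Lemma card_nbrs (A : {set F}) (z x : F) :
  #|nbrs A z x| = (\sum_(a in A) ((a - x)%R ^+ f == z))%N.
Proof.
rewrite -sum1_card big_mkcond [RHS]big_mkcond /=; apply: eq_bigr => a _.
by rewrite inE; case: (a \in A) => //=; case: eqP.
Qed.

(** First moment: a pair [x != a] is counted for exactly one coset, a pair [x = a] for none. *)
Lemma sum_nbrs (A : {set F}) :
  (\sum_(x : F) \sum_(z in unity_roots) #|nbrs A z x| = #|A| * (e * f))%N.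
Proof.
transitivity (\sum_(a in A) \sum_(x : F) (x != a))%N.
  rewrite exchange_big /=; under eq_bigr do under eq_bigr do rewrite card_nbrs.
  under eq_bigr do rewrite exchange_big /=.
  rewrite exchange_big /=; apply: eq_bigr => a _; rewrite exchange_big /=.
  apply: eq_bigr => x _; rewrite eq_sym -subr_eq0 -unity_rootsP.
  case: (boolP (_ \in _)) => h.
    rewrite (bigD1 _ h) /= eqxx big1 // => z /andP[_ /negPf].
    by rewrite eq_sym => ->.
  by rewrite big1 // => z hz; case: eqP h => // ->; rewrite hz.
rewrite -sum_nat_const; apply: eq_bigr => a _.
have := cardsC1 a; rewrite card_F /= => <-; rewrite -sum1_card [RHS]big_mkcond /=.
by apply: eq_bigr => x _; rewrite !inE; case: eqP.
Qed.

(* For a <> a' the Moebius map x |-> (a - x) / (a' - x) is injective and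
   misses 1. *)
Lemma card_common_class (a a' : F) : a != a' ->
  (#|[set x : F | ((a - x != 0) && ((a - x) ^+ f == (a' - x) ^+ f))%R]| <= f.-1)%N.
Proof.
move=> aa'; have [e0 f0] := index_gt0.
set X := [set x | _].
have Xa' x : x \in X -> a' - x != 0.
  rewrite inE => /andP[ax /eqP E]; apply/eqP => E0; move: E.
  by rewrite E0 expr0n gtn_eqF //= => /eqP; rewrite expf_eq0 (negPf ax) andbF.
have injX : {in X &, injective (fun x => (a - x) / (a' - x))}.
  move=> x y hx hy /= /eqP; rewrite eqr_div ?Xa' // => /eqP E.
  have : (a - a') * (x - y) = 0 by rewrite -(subrr ((a - x) * (a' - y))) {2}E; ring.
  by move/eqP; rewrite mulf_eq0 !subr_eq0 (negPf aa') /= => /eqP.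
rewrite -(card_in_imset injX).
have h := card_exp_fiber_le (1 : F) f0.
rewrite (cardsD1 1) inE expr1n eqxx add1n in h.
rewrite -ltnS (prednK f0); apply: leq_trans h; rewrite ltnS.
apply/subset_leq_card/subsetP => _ /imsetP[x hx ->].
rewrite !inE expr_div_n; move: (hx); rewrite inE => /andP[ax /eqP ->].
rewrite divff ?expf_neq0 ?Xa' // eqxx andbT.
apply/eqP => /(congr1 ( *%R^~ (a' - x))); rewrite mul1r mulfVK ?Xa' //.
by move/addIr/eqP; rewrite (negPf aa').
Qed.

(** The squares count triples with [a - x] and [a' - x] in the same coset; the two terms bound the
    cases [a = a'] and [a != a']. *)
Lemma sum_nbrs_sqr (A : {set F}) :
  (\sum_(x : F) \sum_(z in unity_roots) #|nbrs A z x| ^ 2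
     <= #|A| * (e * f) + #|A| * (#|A|.-1 * f.-1))%N.
Proof.
have [e0 f0] := index_gt0.
pose P a a' x := (a - x != 0 :> F) && ((a - x) ^+ f == (a' - x) ^+ f).
have sqE (x : F) : (\sum_(z in unity_roots) #|nbrs A z x| ^ 2 =
   \sum_(a in A) \sum_(a' in A) P a a' x)%N.
  under eq_bigr do rewrite card_nbrs expnS expn1 big_distrlr /=.
  rewrite exchange_big /=; apply: eq_bigr => a _.
  rewrite exchange_big /=; apply: eq_bigr => a' _.
  rewrite /P -unity_rootsP; case: (boolP (_ \in _)) => h.
    rewrite (bigD1 _ h) /= eqxx mul1n eq_sym big1 ?addn0 // => z /andP[_ /negPf].
    by rewrite eq_sym => ->.
  by rewrite big1 // => z hz; case: eqP h => // ->; rewrite hz.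
under eq_bigr do rewrite sqE.
rewrite exchange_big /= -mulnDr -sum_nat_const leq_sum // => a aA.
rewrite exchange_big /= (bigD1 a) //= leq_add //.
  have := cardsC1 a; rewrite card_F /= => <-; rewrite -sum1_card [X in (_ <= X)%N]big_mkcond /=.
  apply: leq_sum => x _; rewrite /P eqxx andbT !inE subr_eq0 eq_sym; by case: eqP.
have -> : #|A|.-1 = #|A :\ a| by rewrite (cardsD1 a A) aA.
rewrite -sum_nat_const.
rewrite [leqRHS](eq_bigl (fun a' => (a' \in A) && (a' != a))); last by move=> y; rewrite !inE andbC.
apply: leq_sum => a' /andP[_]; rewrite eq_sym => aa'.
apply: leq_trans (card_common_class aa'); rewrite -sum1_card [X in (_ <= X)%N]big_mkcond /=.
by apply: leq_sum => x _; rewrite inE /P; case: ifP.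
Qed.

(** Chebyshev's inequality: each [x] counted here falls short of the expected value [#|A| / e] by
    more than half of it. *)
Lemma card_nbrs_small (A : {set F}) (z : F) : z \in unity_roots ->
  (#|[set x : F | 2 * e * #|nbrs A z x| < #|A|]| * #|A| <= (2 * e) ^ 2 * #|F|)%N.
Proof.
move=> zO; have [e0 f0] := index_gt0.
have [->|A0] := eqVneq A set0; first by rewrite cards0 muln0.
have {A0} A0 : (0 < #|A|)%N by rewrite card_gt0.
rewrite -(leq_pmul2r A0).
set X := [set x | _].
(* Deviation from [#|A| / e], multiplied by [e] to remain an integer. *)
pose d (x w : F) : int := (e * #|nbrs A w x|)%:Z - #|A|%:Z.
have S1 := sum_nbrs A; have S2 := sum_nbrs_sqr A.
have lo : ((#|X| * #|A| ^ 2)%:Z <= 4 * \sum_x \sum_(w in unity_roots) d x w ^+ 2 :> int).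
  have -> : (#|X| * #|A| ^ 2)%:Z = \sum_(x in X) #|A|%:Z ^+ 2.
    by rewrite sumr_const -mulr_natr natz; lia.
  rewrite mulr_sumr big_mkcond; apply: ler_sum => x _.
  have ge0 : 0 <= 4 * \sum_(w in unity_roots) d x w ^+ 2.
    by rewrite mulr_ge0 // sumr_ge0 // => w _; rewrite sqr_ge0.
  case: ifP => // ; rewrite inE => hx.
  apply: le_trans (_ : 4 * d x z ^+ 2 <= _).
    by rewrite /d !expr2; nia.
  rewrite ler_pM2l // (bigD1 z) //= lerDl sumr_ge0 // => w _; exact: sqr_ge0.
have E : \sum_x \sum_(w in unity_roots) d x w ^+ 2 =
   e%:Z ^+ 2 * (\sum_(x : F) \sum_(w in unity_roots) #|nbrs A w x| ^ 2)%N%:Z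
   - 2 * e%:Z * #|A|%:Z * (\sum_(x : F) \sum_(w in unity_roots) #|nbrs A w x|)%N%:Z
   + #|F|%:Z * e%:Z * #|A|%:Z ^+ 2.
  have -> : #|F|%:Z * e%:Z * #|A|%:Z ^+ 2 =
     \sum_(x : F) \sum_(w in unity_roots) #|A|%:Z ^+ 2.
    under eq_bigr do rewrite sumr_const card_unity_roots.
    rewrite sumr_const -mulrnA -mulr_natr natz PoszM [RHS]mulrC [e%:Z * _]mulrC.
    by congr (_%:Z * _ * _); apply: eq_card.
  rewrite !Posz_sum !mulr_sumr -sumrB -big_split /=; apply: eq_bigr => x _.
  rewrite !Posz_sum !mulr_sumr -sumrB -big_split /=; apply: eq_bigr => w _.
  by rewrite /d; move: #|A| #|_| => a N; rewrite expnS expn1 !PoszM; ring.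
rewrite E S1 card_F in lo; rewrite card_F.
move: lo S2; set s := (\sum_x _)%N; set x := #|X|; set n := #|A| in A0 *.
move=> lo S2.
case: n A0 lo S2 => // n _; case: (f) f0 => // g _ /= lo S2.
case: (e) e0 lo S2 => // h _ lo S2.
have S2' : (h.+1%:Z ^+ 2 * s%:Z <= h.+1%:Z ^+ 2 * (n.+1 * (h.+1 * g.+1) + n.+1 * (n * g))%N%:Z).
  by rewrite ler_pM2l.
(* The moments bound the sum of squares by [e ^ 2 * #|A| * #|F|] minus the quantities of [p1] and
   [p2], which can thus be dropped. *)
have p1 : 0 <= h.+1%:Z ^+ 2 * n.+1%:Z * g.+1%:Z by rewrite !mulr_ge0.
have p2 : 0 <= h%:Z * h.+1%:Z * n.+1%:Z ^+ 2 by rewrite !mulr_ge0.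
lia.
Qed.

End PowerResidues.

(** * A union bound, and the numbering of pairs *)

Lemma card_bigcup_le (I T : finType) (A : I -> {set T}) :
  #|\bigcup_i A i| <= \sum_i #|A i|.
Proof.
elim/big_rec2: _ => [|i n B _ le_Bn]; first by rewrite cards0.
by rewrite (leq_trans (leq_card_setU _ _)) // leq_add2l.
Qed.

(** The pairs with larger element [j] receive the codes from ['C(j, 2)] up to, but excluding,
    ['C(j.+1, 2)]. *)
Lemma pair_code_lt (k i j : nat) : i < j < k -> 'C(j, 2) + i < 'C(k, 2).
Proof.
case/andP=> ij jk; apply: leq_trans (leq_bin2l 2 jk).
by rewrite binS bin1 -addnS leq_add2l.
Qed.

Lemma pair_code_inj (i j i' j' : nat) : i < j -> i' < j' ->
  'C(j, 2) + i = 'C(j', 2) + i' -> i = i' /\ j = j'.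
Proof.
move=> ij ij'; case: (ltngtP j j') => [jj|jj|<-].
- by have := @pair_code_lt j' i j; rewrite ij jj => /(_ isT); lia.
- by have := @pair_code_lt j i' j'; rewrite ij' jj => /(_ isT); lia.
- by move/addnI.
Qed.

Lemma pair_code_surj (k n : nat) : n < 'C(k, 2) ->
  exists i j, i < j < k /\ n = 'C(j, 2) + i.
Proof.
elim: k => [|k IH]; first by rewrite bin0n.
rewrite binS bin1 => nk; case: (ltnP n 'C(k, 2)) => [/IH|kn].
  by case=> i [j [/andP[ij jk] ->]]; exists i, j; rewrite ij ltnS ltnW.
by exists (n - 'C(k, 2)), k; rewrite subnKC // ltnSn andbT; split=> //; lia.
Qed.

(** * Greedy choice of elements whose differences lie in prescribed cosets *)

Section Greedy.

Local Open Scope ring_scope.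

Variables (F : finFieldType) (e f : nat).
Hypothesis card_F : #|F| = (e * f).+1.

(* Greedy choice of the vertices: [A i] is the set of candidates still
   allowed for the i-th vertex; choosing a vertex shrinks every later
   candidate set by a factor at most [2 * e]. *)
Lemma exists_power_residue_pattern (r m : nat) (A : nat -> {set F})
    (zeta : nat -> nat -> F) :
  (forall i j, (i < j < r)%N -> zeta i j \in unity_roots F e) ->
  (forall i, (i < r)%N -> (#|F| <= #|A i| * (2 * e) ^ m)%N) ->
  (r * (2 * e) ^ (2 * (m + r).+1) < #|F|)%N ->
  exists b : nat -> F, (forall i, (i < r)%N -> b i \in A i) /\
    forall i j, (i < j < r)%N -> (b j - b i) ^+ f = zeta i j.
Proof.
have [e0 f0] := index_gt0 card_F.
have F0 : (0 < #|F|)%N by rewrite card_F.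
have E0 n : (0 < (2 * e) ^ n)%N by rewrite expn_gt0 muln_gt0 e0.
elim: r m A zeta => [|r IH] m A zeta hz hA hF.
  by exists (fun=> 0); split=> // i j; rewrite ltn0 andbF.
pose bad j := [set x : F | (2 * e * #|nbrs f (A j.+1) (zeta 0%N j.+1) x| < #|A j.+1|)%N].
have bad_le (j : 'I_r) : (#|bad j| <= (2 * e) ^ (m.+2))%N.
  have zj : zeta 0%N j.+1 \in unity_roots F e by apply: hz; rewrite /= ltnS.
  have Aj := hA j.+1 (ltn_ord j).
  have Aj0 : (0 < #|A j.+1|)%N by case: posnP Aj => // ->; rewrite mul0n leqNgt F0.
  rewrite -(leq_pmul2r Aj0); apply: leq_trans (card_nbrs_small card_F _ zj) _.
  by rewrite -[m.+2]/(2 + m)%N expnD -mulnA leq_mul2l [X in (_ <= X)%N]mulnC Aj orbT.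
have [x xA0 xgood] : exists2 x, x \in A 0%N & x \notin \bigcup_(j < r) bad j.
  (* The bad points number at most [r * (2 * e) ^ m.+2], while [A 0] has at least
     [#|F| / (2 * e) ^ m] elements, which is more. *)
  have : ~~ (A 0%N \subset \bigcup_(j < r) bad j).
    apply/negP => /subset_leq_card; apply/negP; rewrite -ltnNge.
    apply: leq_ltn_trans (_ : (r * (2 * e) ^ m.+2 < _)%N).
      apply: leq_trans (card_bigcup_le _) _.
      rewrite -[X in (_ <= X * _)%N]card_ord -sum_nat_const; exact: leq_sum.
    rewrite -(ltn_pmul2r (E0 m)); apply: leq_trans (hA 0%N isT).
    apply: leq_ltn_trans hF; rewrite -mulnA -expnD leq_mul //.
    by rewrite leq_pexp2l ?muln_gt0 //; lia.
  by case/subsetPn => x xA xB; exists x.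
have {}xgood j : (j < r)%N ->
    (#|A j.+1| <= 2 * e * #|nbrs f (A j.+1) (zeta 0%N j.+1) x|)%N.
  move=> jr; rewrite leqNgt; apply/negP => xb; case/negP: xgood.
  by apply/bigcupP; exists (Ordinal jr) => //; rewrite inE.
have [] := IH m.+1 (fun j => nbrs f (A j.+1) (zeta 0%N j.+1) x)
                  (fun i j => zeta i.+1 j.+1).
- by move=> i j ij; apply: hz.
- move=> i ir; apply: leq_trans (hA i.+1 ir) _.
  by rewrite /= expnS mulnA leq_mul2r [(#|_| * _)%N]mulnC xgood ?orbT.
(* The exponent depends only on [m + r], which is the same for [m.+1, r] and [m, r.+1]. *)
- by rewrite addSnnS; apply: leq_ltn_trans hF; rewrite leq_mul.
move=> b [bA bz]; exists (fun i => if i is i'.+1 then b i' else x); split.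
  by case=> // i /bA; rewrite inE => /andP[].
case=> [|i] [|j] //; last exact: bz.
by move=> /andP[_ /bA]; rewrite inE => /andP[_ /eqP].
Qed.

(** Prescribe for the pair [i < j] the root of unity numbered by its code: there are as many pairs
    as cosets, so each coset is used once. *)
Lemma exists_difference_representatives (k : nat) : e = 'C(k, 2) ->
  (k * (2 * e) ^ (2 * k.+1) < #|F|)%N ->
  exists b : nat -> F, (forall i j : 'I_k, i != j -> b j - b i != 0) /\
    forall z, z \in unity_roots F e ->
     exists i j, (i < j < k)%N /\ (b j - b i) ^+ f = z /\
       forall i' j', (i' < j' < k)%N -> (b j' - b i') ^+ f = z -> i' = i /\ j' = j.
Proof.
move=> ek hq; set O := unity_roots F e.
have sO : size (enum O) = e by rewrite -cardE (card_unity_roots card_F).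
pose zeta i j := nth 0 (enum O) ('C(j, 2) + i).
have zO i j : (i < j < k)%N -> zeta i j \in O.
  by move=> ijk; rewrite -mem_enum mem_nth // sO ek pair_code_lt.
have [] := @exists_power_residue_pattern k 0 (fun=> setT) zeta zO _ hq.
  by move=> i _; rewrite muln1 cardsT.
move=> b [_ bz]; have b_neq i j : (i < j < k)%N -> b j - b i != 0.
  by move=> ijk; rewrite -(unity_rootsP card_F) bz ?zO.
exists b; split=> [i j ij|z zO'].
  case: (ltngtP i j) => [lt|lt|/val_inj E]; last by rewrite E eqxx in ij.
    by apply: b_neq; rewrite lt /=.
  by rewrite -opprB oppr_eq0 b_neq // lt /=.
have zi : (index z (enum O) < 'C(k, 2))%N by rewrite -ek -sO index_mem mem_enum.
have [i [j [ijk zE]]] := pair_code_surj zi.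
have ijz : zeta i j = z by rewrite /zeta -zE nth_index // mem_enum.
exists i, j; split=> //; split; first by rewrite bz.
move=> i' j' ijk'; rewrite bz // -ijz => /eqP.
rewrite /zeta nth_uniq ?enum_uniq ?sO ?ek ?pair_code_lt // => /eqP.
by case/andP: ijk ijk' => ij _ /andP[ij' _]; apply: pair_code_inj.
Qed.

End Greedy.

(** * A [G]-invariant set of directions *)

Section InvariantDirections.

Local Open Scope ring_scope.

Variables (F : finFieldType) (gT : finGroupType) (G : {group gT}).
Variables (V : lmodType F) (act : V -> gT -> V).
Hypothesis act1 : forall u, act u 1%g = u.
Hypothesis actM : forall u g h, act u (g * h)%g = act (act u g) h.
Hypothesis actZ : forall c u g, act (c *: u) g = c *: act u g.

Let n := #|G|.

Lemma act0 (g : gT) : act 0 g = 0.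
Proof. by rewrite -(scale0r (0 : V)) actZ !scale0r. Qed.

Lemma act_neq0 (u : V) (g : gT) : u != 0 -> act u g != 0.
Proof.
apply: contraNneq => u0.
by rewrite -(act1 u) -(mulgV g) actM u0 act0.
Qed.

Definition scaled_orbit (u : V) : pred V := fun w =>
  [exists c : F, exists g in G, (c != 0) && (w == c *: act u g)].

Lemma scaled_orbitP (u w : V) :
  reflect (exists c g, [/\ c != 0, g \in G & w = c *: act u g])
          (scaled_orbit u w).
Proof.
apply: (iffP existsP) => [[c /exists_inP[g gG /andP[c0 /eqP wE]]]|[c [g [c0 gG wE]]]].
  by exists c, g.
by exists c; apply/exists_inP; exists g; rewrite // c0 wE eqxx.
Qed.

Lemma scaled_orbit_refl (u : V) : scaled_orbit u u.
Proof. by apply/scaled_orbitP; exists 1, 1%g; rewrite oner_eq0 act1 scale1r. Qed.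

Lemma scaled_orbit_sym (u w : V) : scaled_orbit u w -> scaled_orbit w u.
Proof.
case/scaled_orbitP=> c [g [c0 gG ->]]; apply/scaled_orbitP.
exists c^-1, g^-1%g; rewrite invr_eq0 groupV; split=> //.
by rewrite actZ -actM mulgV act1 scalerA mulVf // scale1r.
Qed.

Lemma scaled_orbit_trans (u w x : V) :
  scaled_orbit u w -> scaled_orbit w x -> scaled_orbit u x.
Proof.
case/scaled_orbitP=> c [g [c0 gG ->]] /scaled_orbitP[d [h [d0 hG ->]]].
apply/scaled_orbitP; exists (d * c), (g * h)%g.
by rewrite mulf_neq0 // groupM // actZ actM scalerA.
Qed.

Definition orbit_rep (u : V) : V := choose (scaled_orbit u) u.

Lemma orbit_repP (u : V) : scaled_orbit (orbit_rep u) u.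
Proof. exact/scaled_orbit_sym/chooseP/scaled_orbit_refl. Qed.

(** Vectors of one orbit have extensionally equal orbit predicates, and [choose] does not depend on
    the witness supplied. *)
Lemma orbit_rep_eq (u w : V) : scaled_orbit u w -> orbit_rep w = orbit_rep u.
Proof.
move=> uw; rewrite /orbit_rep (@eq_choose _ _ (scaled_orbit u)).
  by apply: choose_id => //; apply: scaled_orbit_refl.
by move=> x; apply/idP/idP; apply: scaled_orbit_trans => //; apply: scaled_orbit_sym.
Qed.

(** Iterating the relation [n] times replaces [g] by [g ^+ n = 1]. *)
Lemma stabilizer_scalar (w : V) (c : F) (g : gT) :
  w != 0 -> g \in G -> c *: act w g = w -> c ^+ n = 1.
Proof.
move=> w0 gG wE.
have itE m : c ^+ m *: act w (g ^+ m)%g = w.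
  elim: m => [|m IH]; first by rewrite expr0 expg0 act1 scale1r.
  by rewrite exprS expgSr actM -scalerA -actZ IH wE.
have gn : (g ^+ n)%g = 1%g by rewrite expg_cardG.
apply/eqP; rewrite -subr_eq0.
have := itE n; rewrite gn act1 => /eqP.
by rewrite -subr_eq0 -{2}[w]scale1r -scalerBl scaler_eq0 (negPf w0) orbF.
Qed.

(* A degree #|G| homogeneous, G-invariant function: if u = c *: r ^ g with r the
   chosen representative of its orbit, c is unique up to #|G|-th roots of 1. *)
Definition orbit_norm (u : V) : F :=
  if [pick p : F * gT | [&& p.1 != 0, p.2 \in G & u == p.1 *: act (orbit_rep u) p.2]]
  is Some p then p.1 ^+ n else 0.

Lemma orbit_norm_eq (u : V) (c : F) (g : gT) : u != 0 -> c != 0 -> g \in G ->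
  u = c *: act (orbit_rep u) g -> orbit_norm u = c ^+ n.
Proof.
move=> u0 c0 gG uE; rewrite /orbit_norm; case: pickP => [[d h] /= /and3P[d0 hG /eqP uE']|].
  have r0 : orbit_rep u != 0.
    apply: contraNneq u0 => r0.
    by rewrite uE r0 act0 scaler0.
  (* By the two expressions of [u], [h * g^-1] maps the line of the representative to itself, with
     scalar [c^-1 * d] undoing it. *)
  have : (c^-1 * d) ^+ n = 1.
    apply: (@stabilizer_scalar (orbit_rep u) _ (h * g^-1)%g r0); first by rewrite groupM ?groupV.
    by rewrite actM -scalerA -actZ -uE' {1}uE actZ -actM mulgV act1 scalerA mulVf // scale1r.
  rewrite exprMn exprVn => /(canRL (mulKf _)) -> ; last by rewrite invr_eq0 expf_neq0.
  by rewrite invrK mulr1.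
by move/(_ (c, g)); rewrite /= c0 gG -uE eqxx.
Qed.

Lemma orbit_norm_power (u : V) : u != 0 -> exists2 c, c != 0 & orbit_norm u = c ^+ n.
Proof.
move=> u0; case/scaled_orbitP: (orbit_repP u) => c [g [c0 gG uE]].
by exists c => //; apply: orbit_norm_eq uE.
Qed.

Lemma orbit_norm_equivariant (u : V) (t : F) (g : gT) :
  u != 0 -> t != 0 -> g \in G -> orbit_norm (t *: act u g) = t ^+ n * orbit_norm u.
Proof.
move=> u0 t0 gG; case/scaled_orbitP: (orbit_repP u) => c [h [c0 hG uE]].
rewrite (orbit_norm_eq u0 c0 hG uE) -exprMn.
apply: (@orbit_norm_eq _ _ (h * g)%g); rewrite ?mulf_neq0 ?groupM //.
  by rewrite scaler_eq0 negb_or t0 act_neq0.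
rewrite (@orbit_rep_eq u).
  by rewrite -scalerA actM -[c *: _]actZ -uE.
by apply/scaled_orbitP; exists t, g.
Qed.

Variables (e m k : nat) (b : nat -> F).
Hypothesis card_F : #|F| = (e * (n * m)).+1.
Hypotheses (n_odd : odd n) (m_even : ~~ odd m).
Hypothesis two_neq0 : (2 : F) != 0.
Hypothesis b_inj : forall i j : 'I_k, i != j -> b j - b i != 0.
Hypothesis b_classes : forall z, z \in unity_roots F e ->
  exists i j, (i < j < k)%N /\ (b j - b i) ^+ (n * m) = z /\
    forall i' j', (i' < j' < k)%N -> (b j' - b i') ^+ (n * m) = z -> i' = i /\ j' = j.

(* The comparison of ranks selects one element of each pair {x, -x}. *)
Definition positive (x : F) : bool := (enum_rank x < enum_rank (- x)%R)%N.

Lemma positiveN (x : F) : x != 0 -> positive (- x) = ~~ positive x.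
Proof.
move=> x0; rewrite /positive opprK -leqNgt [RHS]leq_eqVlt orb_idl //.
move=> /eqP/val_inj/enum_rank_inj/eqP.
by rewrite eq_sym -addr_eq0 -mulr2n -mulr_natl mulf_eq0 (negPf two_neq0) (negPf x0).
Qed.

(** Scaling [u] by [t] multiplies [orbit_norm u ^+ m] by [t ^+ (n * m)], so the second condition
    selects one coset on each line. As [n] is odd and [m] even, passing to [- u] negates the norm
    but keeps its [m]-th power, so the third selects one of [u], [- u]. *)
Definition direction (u : V) : bool :=
  [&& u != 0, orbit_norm u ^+ m == 1 & positive (orbit_norm u)].

Lemma direction_act (u : V) (g : gT) : g \in G -> direction u -> direction (act u g).
Proof.
move=> gG /and3P[u0 um up]; rewrite /direction act_neq0 //=.
have := orbit_norm_equivariant u0 (oner_neq0 F) gG.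
by rewrite scale1r expr1n mul1r => ->; rewrite um.
Qed.

Lemma orbit_normZ (u : V) (t : F) : u != 0 -> t != 0 ->
  orbit_norm (t *: u) = t ^+ n * orbit_norm u.
Proof. by move=> u0 t0; rewrite -{1}[u]act1 orbit_norm_equivariant ?group1. Qed.

(** With [orbit_norm u = c ^+ n], the difference must lie in the coset of [c]. This fixes the
    unordered pair of indices, and the sign condition then fixes its order. *)
Lemma direction_unique (u : V) : u != 0 ->
  exists i j : 'I_k, [/\ i != j, direction ((b j - b i)^-1 *: u) &
    forall i' j' : 'I_k, i' != j' -> direction ((b j' - b i')^-1 *: u) ->
      i' = i /\ j' = j].
Proof.
move=> u0; have [c c0 normE] := orbit_norm_power u0.
have nm0 : (0 < n * m)%N by case: (index_gt0 card_F).
have cO : c ^+ (n * m) \in unity_roots F e by rewrite (unity_rootsP card_F).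
have dirE d : d != 0 -> direction (d^-1 *: u) =
    (c ^+ (n * m) == d ^+ (n * m)) && positive (d ^- n * c ^+ n).
  move=> d0; rewrite /direction scaler_eq0 invr_eq0 (negPf d0) (negPf u0) /=.
  rewrite orbit_normZ ?invr_eq0 // normE exprVn exprMn exprVn -!exprM.
  congr (_ && _); rewrite -(inj_eq (mulfI (expf_neq0 (n * m) d0))) mulVKf ?mulr1 //.
  exact: expf_neq0.
have oppE d : (- d) ^+ (n * m) = d ^+ (n * m) :> F.
  by rewrite exprNn -signr_odd oddM (negPf m_even) andbF expr0 mul1r.
have posN d : d != 0 -> positive ((- d) ^- n * c ^+ n) = ~~ positive (d ^- n * c ^+ n).
  move=> d0; rewrite exprNn -signr_odd n_odd expr1 mulN1r invrN mulNr positiveN //.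
  by rewrite mulf_neq0 ?invr_eq0 ?expf_neq0.
have [i [j [/andP[ij jk] [bE uniq]]]] := b_classes cO.
have ik := ltn_trans ij jk.
pose i0 := Ordinal ik; pose j0 := Ordinal jk.
have d0 : b j - b i != 0.
  by apply: (b_inj (i := i0) (j := j0)); rewrite -(inj_eq val_inj) /= ltn_eqF.
have uniq' (i' j' : 'I_k) : i' != j' -> direction ((b j' - b i')^-1 *: u) ->
    (i' = i0 /\ j' = j0 \/ i' = j0 /\ j' = i0) /\ positive ((b j' - b i') ^- n * c ^+ n).
  move=> ij'; rewrite dirE ?b_inj // => /andP[/eqP E ->]; split=> //.
  case: (ltngtP i' j') => [lt|lt|/val_inj Eij]; last by rewrite Eij eqxx in ij'.
    have [] := uniq i' j'; rewrite ?lt /= // => Ei Ej.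
    by left; split; apply: val_inj.
  have [] := uniq j' i'; rewrite ?lt /= // -?(opprB (b j')) ?oppE // => Ei Ej.
  by right; split; apply: val_inj.
have [pos|neg] := boolP (positive ((b j - b i) ^- n * c ^+ n)).
  exists i0, j0; split.
  - by rewrite -(inj_eq val_inj) /= ltn_eqF.
  - by rewrite dirE //= bE eqxx.
  - move=> i' j' ij' /(uniq' _ _ ij')[[//|[-> ->]]] /=.
    by rewrite -opprB posN // pos.
exists j0, i0; split.
- by rewrite -(inj_eq val_inj) /= gtn_eqF.
- by rewrite /= -opprB dirE ?oppr_eq0 //= oppE bE eqxx posN.
- by move=> i' j' ij' /(uniq' _ _ ij')[[[-> ->]|//]] /=; rewrite (negPf neg).
Qed.

End InvariantDirections.

(** * The design of translates and the action of [G] on it *)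

Section TranslateDesign.

Local Open Scope ring_scope.

Variables (F : finFieldType) (gT : finGroupType).

Local Notation V := {ffun gT -> F^o}.

(** Multiplying the argument on the left yields a right action, in agreement with the order of
    products in [permM]. *)
Definition shift (u : V) (g : gT) : V := [ffun x => u (g * x)%g].

Lemma shift1 (u : V) : shift u 1%g = u.
Proof. by apply/ffunP=> x; rewrite ffunE mul1g. Qed.

Lemma shiftM (u : V) (g h : gT) : shift u (g * h)%g = shift (shift u g) h.
Proof. by apply/ffunP=> x; rewrite !ffunE mulgA. Qed.

Lemma shiftZ (c : F) (u : V) (g : gT) : shift (c *: u) g = c *: shift u g.
Proof. by apply/ffunP=> x; rewrite !ffunE. Qed.

Lemma shiftD (u w : V) (g : gT) : shift (u + w) g = shift u g + shift w g.
Proof. by apply/ffunP=> x; rewrite !ffunE. Qed.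

Lemma shift_inj (g : gT) : injective (shift ^~ g).
Proof.
by apply: (@can_inj _ _ _ (shift ^~ g^-1%g)) => u; rewrite -shiftM mulgV shift1.
Qed.

Definition shift_perm (g : gT) : {perm V} := perm (@shift_inj g).

Lemma shift_permM : {morph shift_perm : g h / (g * h)%g}.
Proof. by move=> g h; apply/permP=> u; rewrite permM !permE shiftM. Qed.

Lemma shift_perm_inj : injective shift_perm.
Proof.
(* Test on the indicator of [g]: its shift by [h] takes the value 1 at the identity only if
   [h = g]. *)
move=> g h /permP/(_ [ffun x => (x == g)%:R]).
rewrite !permE => /ffunP/(_ 1%g); rewrite !ffunE !mulg1 eqxx.
by case: eqP => // _ /eqP; rewrite oner_eq0.
Qed.

Variables (G : {group gT}) (k : nat) (b : nat -> F) (D : pred V).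
Hypothesis b_inj : forall i j : 'I_k, i != j -> b j - b i != 0.
Hypothesis D_neq0 : forall u, D u -> u != 0.
Hypothesis D_shift : forall u g, g \in G -> D u -> D (shift u g).
Hypothesis D_unique : forall u, u != 0 ->
  exists i j : 'I_k, [/\ i != j, D ((b j - b i)^-1 *: u) &
    forall i' j' : 'I_k, i' != j' -> D ((b j' - b i')^-1 *: u) ->
      i' = i /\ j' = j].

Definition translate (w u : V) : {set V} := [set w + b i *: u | i : 'I_k].

Definition translate_blocks : {set {set V}} :=
  [set translate p.1 p.2 | p : V * V & D p.2].

Lemma translate_blocksP (B : {set V}) :
  reflect (exists w u, D u /\ B = translate w u) (B \in translate_blocks).
Proof.
apply: (iffP imsetP) => [[[w u] /=]|[w [u [Du ->]]]].
  by rewrite inE /= => Du ->; exists w, u.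
by exists (w, u); rewrite ?inE.
Qed.

(** A block through [x] and [y] at indices [i], [j] has [y - x = (b j - b i) *: u] and base point
    [x - b i *: u], so [D_unique] at [y - x] determines it. *)
Lemma translate_design : is_design #|{: V}| k translate_blocks.
Proof.
split=> // [B /translate_blocksP[w [u [Du ->]]]|x y xy].
  rewrite card_imset ?card_ord // => i j /addrI/eqP.
  rewrite -subr_eq0 -scalerBl scaler_eq0 (negPf (D_neq0 Du)) orbF => E.
  by apply/eqP; apply: contraTT E; rewrite eq_sym; apply: b_inj.
have yx0 : y - x != 0 by rewrite subr_eq0 eq_sym.
have [i [j [ij Dd uniq]]] := D_unique yx0.
set d := b j - b i in Dd; set u := d^-1 *: (y - x) in Dd.
have d0 : d != 0 by apply: b_inj.
have yE : y = x - b i *: u + b j *: u.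
  by rewrite -addrA [- _ + _]addrC -scalerBl -/d scalerA divff // scale1r addrC subrK.
exists (translate (x - b i *: u) u); split.
  split; first by apply/translate_blocksP; exists (x - b i *: u), u.
    by apply/imsetP; exists i; rewrite ?subrK.
  by apply/imsetP; exists j.
move=> B [/translate_blocksP[w [u' [Du' ->]]] /imsetP[i' _ xE'] /imsetP[j' _ yE']].
have dE : y - x = (b j' - b i') *: u'.
  by rewrite yE' xE' opprD addrACA subrr add0r scalerBl.
have ij' : i' != j' by apply: contraNneq yx0 => E; rewrite dE E subrr scale0r.
have uE' : u' = (b j' - b i')^-1 *: (y - x).
  by rewrite dE scalerA mulVf ?scale1r // b_inj.
have [] := uniq i' j' ij'; first by rewrite -uE'.
move=> Ei Ej; rewrite Ei Ej -/d -/u in uE'.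
by rewrite uE' xE' Ei uE' addrK.
Qed.

Lemma shift_perm_aut (g : gT) : g \in G -> shift_perm g \in design_aut translate_blocks.
Proof.
(* The induced map on sets is injective, so mapping blocks to blocks suffices. *)
move=> gG; rewrite inE eqEcard; apply/andP; split; last first.
  by rewrite [leqRHS]card_imset //; apply: imset_inj; apply: perm_inj.
apply/subsetP => _ /imsetP[_ /translate_blocksP[w [u [Du ->]]] ->].
apply/translate_blocksP; exists (shift w g), (shift u g); split; first exact: D_shift.
rewrite -imset_comp; apply: eq_imset => i /=.
by rewrite permE shiftD shiftZ.
Qed.

Lemma shift_group_isog : exists H : {group {perm V}},
  H \subset design_aut translate_blocks /\ (H \isog G)%g.
Proof.
have sM : {in G &, {morph shift_perm : g h / (g * h)%g}} by move=> g h _ _; apply: shift_permM.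
exists [group of (Morphism sM @* G)%g]; split.
  by apply/subsetP => _ /morphimP[g _ gG ->]; apply: shift_perm_aut.
apply: isog_symr; apply: sub_isog; first exact: subxx.
by apply/injmP => g h _ _; apply: shift_perm_inj.
Qed.

End TranslateDesign.

(** * Choice of the field and conclusion *)

(** Take a prime [p > M] and the field of order [p ^ (totient M * N.+1)]: Euler's theorem gives the
    congruence, and [p > 2] the last claim. *)
Lemma exists_large_finField (M N : nat) : 1 < M ->
  exists F : finFieldType, [/\ N < #|F|, M %| #|F|.-1 & (2%:R != 0 :> F)%R].
Proof.
move=> M1; have [p pM pp] := prime_above M.
have copM : coprime p M.
  by rewrite prime_coprime //; apply/negP => /dvdn_leq; lia.
have t0 : 0 < totient M by rewrite totient_gt0; lia.
have e0 : 0 < totient M * N.+1 by rewrite muln_gt0 t0.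
have [F charF cardF] := pPrimePowerField pp e0.
exists F; rewrite cardF; split.
- apply: leq_trans (_ : totient M * N.+1 <= _); first by rewrite leq_pmull.
  by rewrite ltnW // ltn_expl // prime_gt1.
- rewrite -subn1 -eqn_mod_dvd ?expn_gt0 ?prime_gt0 //.
  by rewrite expnM -modnXm Euler_exp_totient // modnXm exp1n.
- by rewrite -(dvdn_pcharf charF); apply/negP => /dvdn_leq; lia.
Qed.

Theorem theorem2p2 (k : nat) (hk : 3 <= k)
    (gT : finGroupType) (G : {group gT}) (hG : odd #|G|) :
  forall N : nat, exists v : nat, N < v /\
    exists (T : finType) (B : {set {set T}}),
      is_design v k B /\
      exists H : {group {perm T}}, H \subset design_aut B /\ H \isog G.
Proof.
move=> N; set n := #|G|; pose e := 'C(k, 2).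
have e0 : 0 < e by rewrite bin_gt0 ltnW.
have n0 : 0 < n by apply: cardG_gt0.
have M1 : 1 < 2 * n * e by rewrite -mulnA (@leq_pmulr 2) // muln_gt0 n0.
(* The second bound is the one the greedy choice needs; the factor 2 in the modulus makes the
   exponent [m = 2 * h] even. *)
have [F [qN /dvdnP[h qh] two0]] :=
  exists_large_finField (maxn N (k * (2 * e) ^ (2 * k.+1))) M1.
move: qN; rewrite gtn_max => /andP[qN qk].
have cardF : #|F| = (e * (n * (2 * h))).+1.
  by rewrite -(prednK (ltnW (finNzRing_gt1 F))) qh; congr _.+1; lia.
have m_even : ~~ odd (2 * h) by rewrite mul2n odd_double.
have [b [b_inj b_classes]] := exists_difference_representatives cardF (erefl e) qk.
pose D := @direction F gT G {ffun gT -> F^o} (@shift F gT) (2 * h).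
have D_neq0 u : D u -> (u != 0)%R by case/and3P.
have D_shift u g : g \in G -> D u -> D (shift u g).
  by apply: direction_act; [apply: shift1 | apply: shiftM | apply: shiftZ].
have D_unique := direction_unique (@shift1 F gT) (@shiftM F gT) (@shiftZ F gT)
   cardF hG m_even two0 b_inj b_classes.
exists #|{: {ffun gT -> F^o}}|; split.
  (* The number of points is [#|F| ^ #|gT|], hence at least [#|F| > N]. *)
  rewrite card_ffun; apply: leq_trans qN _.
  rewrite -{1}[#|F|]expn1 leq_pexp2l //; first by rewrite cardF.
  by apply/card_gt0P; exists 1%g.
exists {ffun gT -> F^o}, (translate_blocks k b D); split.
  exact: translate_design.
exact: shift_group_isog.
Qed.
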